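(* Let $r\ge 2$, let $\mathcal F$ be a nondegenerate family of $r$-graphs, and let $\mathfrak H$ be a hereditary class of $\mathcal F$-free $r$-graphs. If $\mathcal F$ is vertex-stable with respect to $\mathfrak H$ and vertex-extendable with respect to $\mathfrak H$, then $\mathcal F$ is degree-stable with respect to $\mathfrak H$.
   Context: An $r$-graph is a finite $r$-uniform hypergraph $\mathcal H$, identified with its edge set, with vertex set $V(\mathcal H)$; $|\mathcal H|$ is its number of edges, $\delta(\mathcal H)$ its minimum vertex degree (the degree of a vertex is the number of edges containing it), and $\mathcal H-v$ is obtained by deleting the vertex $v$ and all edges containing it. $\mathcal H$ is $\mathcal F$-free if it contains no member of $\mathcal F$ as a (not necessarily induced) subgraph; $\mathrm{ex}(n,\mathcal F)$ is the maximum number of edges of an $\mathcal F$-free $r$-graph on $n$ vertices; $\pi(\mathcal F)=\lim_{n\to\infty}\mathrm{ex}(n,\mathcal F)/\binom nr$; $\mathcal F$ is nondegenerate if $\pi(\mathcal F)>0$. Classes of $r$-graphs are understood to be closed under isomorphism; a class is hereditary if it is closed under taking induced subgraphs. Vertex-stable with respect to $\mathfrak H$: for every $\delta>0$ there exist $\epsilon>0$ and $N_0\in\mathbb N$ such that every $\mathcal F$-free $r$-graph $\mathcal H$ on $n\ge N_0$ vertices with $|\mathcal H|\ge(\pi(\mathcal F)/r!-\epsilon)n^r$ becomes a subgraph of some member of $\mathfrak H$ after removing at most $\delta n$ vertices. Vertex-extendable with respect to $\mathfrak H$: there exist $\zeta>0$ and $N_0\in\mathbb N$ such that for every $\mathcal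 F$-free $r$-graph $\mathcal H$ on $n\ge N_0$ vertices with $\delta(\mathcal H)\ge(\pi(\mathcal F)/(r-1)!-\zeta)n^{r-1}$ the following holds: if $\mathcal H-v$ is a subgraph of a member of $\mathfrak H$ for some vertex $v\in V(\mathcal H)$, then $\mathcal H$ is a subgraph of a member of $\mathfrak H$. Degree-stable with respect to $\mathfrak H$: there exist $\epsilon>0$ and $N_0$ such that every $\mathcal F$-free $r$-graph $\mathcal H$ on $n\ge N_0$ vertices with $\delta(\mathcal H)\ge(\pi(\mathcal F)/(r-1)!-\epsilon)n^{r-1}$ is a subgraph of some member of $\mathfrak H$. *)

(* Defs.v *)
From HB Require Import structures.
From mathcomp Require Import all_boot all_order all_algebra.
From mathcomp Require Import boolp classical_sets reals topology normedtype sequences.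

Set Implicit Arguments.
Unset Strict Implicit.
Unset Printing Implicit Defensive.

Import Order.TTheory GRing.Theory Num.Theory.
Import numFieldNormedType.Exports.

Local Open Scope ring_scope.

Record hgraph (r : nat) := HGraph {
  vertices : finType;
  edges : {set {set vertices}};
  edges_uniform : forall e, e \in edges -> #|e| = r
}.

(* Not [set (hgraph r)]: the universe of [set] lies below that of finType. *)
Definition hclass (r : nat) := hgraph r -> Prop.

Definition nverts r (H : hgraph r) : nat := #|vertices H|.

Definition nedges r (H : hgraph r) : nat := #|edges H|.

Definition degree r (H : hgraph r) (v : vertices H) : nat :=
  #|[set e in edges H | v \in e]|.

(* Every degree is at most [nedges H], so the default value of the minimum
   matters only for r-graphs without vertices. *)
Definition min_degree r (H : hgraph r) : nat :=
  \big[minn/nedges H]_(v : vertices H) degree v.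

Section Induced.
Variables (r : nat) (H : hgraph r) (S : {set vertices H}).

Definition induced_edges : {set {set {x : vertices H | x \in S}}} :=
  [set e : {set {x | x \in S}} | val @: e \in edges H].

Lemma induced_uniform e : e \in induced_edges -> #|e| = r.
Proof.
by rewrite inE => /edges_uniform; rewrite card_imset //; exact: val_inj.
Qed.

Definition induced_hgraph : hgraph r := HGraph induced_uniform.

End Induced.

Definition delete_set r (H : hgraph r) (S : {set vertices H}) : hgraph r :=
  induced_hgraph (~: S).

Definition delete_vertex r (H : hgraph r) (v : vertices H) : hgraph r :=
  delete_set [set v].

Definition subgraph r (G H : hgraph r) : Prop :=
  exists f : vertices G -> vertices H,
    injective f /\ forall e : {set vertices G}, e \in edges G -> f @: e \in edges H.

Definition isomorphic r (G H : hgraph r) : Prop :=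
  exists f : vertices G -> vertices H,
    bijective f /\
    forall e : {set vertices G}, (f @: e \in edges H) = (e \in edges G).

Definition iso_closed r (HH : hclass r) : Prop :=
  forall G H : hgraph r, isomorphic G H -> HH G -> HH H.

Definition hereditary r (HH : hclass r) : Prop :=
  forall (H : hgraph r) (S : {set vertices H}), HH H -> HH (induced_hgraph S).

Definition Ffree r (F : hclass r) (H : hgraph r) : Prop :=
  forall G : hgraph r, F G -> ~ subgraph G H.

Definition sub_member r (HH : hclass r) (H : hgraph r) : Prop :=
  exists G : hgraph r, HH G /\ subgraph H G.

(* An r-graph on n vertices has at most 'C(n, r) edges, so the bound on m
   excludes nothing. *)
Definition turan_number r (F : hclass r) (n : nat) : nat :=
  (\max_(m < 'C(n, r).+1 |
      `[< exists H : hgraph r, [/\ Ffree F H, nverts H = n & nedges H = m] >]) m)%N.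

Definition turan_density (R : realType) r (F : hclass r) : R :=
  lim ((fun n : nat => (turan_number F n)%:R / 'C(n, r)%:R : R) @ \oo)%classic.

Definition nondegenerate_family (R : realType) r (F : hclass r) : Prop :=
  0 < turan_density R F.

Definition vertex_stable (R : realType) r (F HH : hclass r) : Prop :=
  forall delta : R, 0 < delta ->
  exists (eps : R) (N0 : nat), 0 < eps /\
    forall H : hgraph r,
      Ffree F H ->
      (N0 <= nverts H)%N ->
      (turan_density R F / r`!%:R - eps) * (nverts H)%:R ^+ r <= (nedges H)%:R ->
      exists S : {set vertices H},
        #|S|%:R <= delta * (nverts H)%:R /\ sub_member HH (delete_set S).

Definition vertex_extendable (R : realType) r (F HH : hclass r) : Prop :=
  exists (zeta : R) (N0 : nat), 0 < zeta /\
    forall H : hgraph r,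
      Ffree F H ->
      (N0 <= nverts H)%N ->
      (turan_density R F / (r.-1)`!%:R - zeta) * (nverts H)%:R ^+ r.-1
        <= (min_degree H)%:R ->
      (exists v : vertices H, sub_member HH (delete_vertex v)) ->
      sub_member HH H.

Definition degree_stable (R : realType) r (F HH : hclass r) : Prop :=
  exists (eps : R) (N0 : nat), 0 < eps /\
    forall H : hgraph r,
      Ffree F H ->
      (N0 <= nverts H)%N ->
      (turan_density R F / (r.-1)`!%:R - eps) * (nverts H)%:R ^+ r.-1
        <= (min_degree H)%:R ->
      sub_member HH H.

(* Main.v *)
Require Import Defs.
From mathcomp Require Import all_boot all_order all_algebra.
From mathcomp Require Import reals.
From mathcomp Require Import lra.

(** The degree condition gives many edges, so vertex-stability places [H - S]
    inside a member of the class for some small [S].  The vertices of [S] are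
    put back one at a time: every intermediate graph [H - T], [T \subset S],
    has minimum degree at least [delta(H) - |T| n^(r-2)], because at most
    [n^(r-2)] edges contain two given vertices, so vertex-extendability applies
    at each step. *)

Set Implicit Arguments.
Unset Strict Implicit.
Unset Printing Implicit Defensive.

Import Order.TTheory GRing.Theory Num.Theory.

Section Subgraphs.
Variable r : nat.
Implicit Types (G H K : hgraph r) (F HH : hclass r).

Lemma subgraph_trans G H K : subgraph G H -> subgraph H K -> subgraph G K.
Proof.
move=> [f [f_inj fE]] [g [g_inj gE]]; exists (g \o f).
split=> [|e eG]; first exact: inj_comp.
by rewrite imset_comp; apply/gE/fE.
Qed.

Lemma induced_subgraph H (S : {set vertices H}) : subgraph (induced_hgraph S) H.
Proof. by exists val; split=> [|e]; [exact: val_inj | rewrite inE]. Qed.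

Lemma subgraph_delete_set0 H : subgraph H (delete_set (set0 : {set vertices H})).
Proof.
have inT v : v \in ~: (set0 : {set vertices H}) by rewrite !inE.
exists (fun v => Sub v (inT v)); split=> [v w /(congr1 val)//|e eH].
rewrite inE -imset_comp (_ : [set _ | x in e] = e) //.
by rewrite (eq_imset (g := id)) ?imset_id.
Qed.

Lemma Ffree_subgraph F G H : subgraph G H -> Ffree F H -> Ffree F G.
Proof. by move=> GH freeH K /freeH nKH KG; apply/nKH/(subgraph_trans KG). Qed.

Lemma sub_member_subgraph HH G H :
  subgraph G H -> sub_member HH H -> sub_member HH G.
Proof. by move=> GH [K [HK sHK]]; exists K; split=> //; apply: subgraph_trans sHK. Qed.

(** The two graphs live on different subset types, so they are compared by an embedding. One
    direction suffices, since [sub_member] passes to subgraphs. *)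
Lemma delete_vertex_delete_set H (S : {set vertices H})
    (v : vertices (delete_set S)) :
  subgraph (delete_vertex v) (delete_set (val v |: S)).
Proof.
have inT (w : vertices (delete_vertex v)) : val (val w) \in ~: (val v |: S).
  rewrite in_setC in_setU1 negb_or.
  move: (valP w) (valP (val w)); rewrite !in_setC in_set1 => wv -> /=.
  by rewrite andbT (inj_eq val_inj).
exists (fun w => Sub (val (val w)) (inT w)); split=> [u w /(congr1 val)/=|e].
  by move/val_inj/val_inj.
by rewrite !inE -!imset_comp.
Qed.

(** Induction on the size of [S]: extending over one [v] in [S] replaces [S] by [S :\ v]. Extension
    is assumed only over subsets of [S], so that a bound on the size of [S] controls every
    intermediate graph. *)
Lemma sub_member_delete_set HH H (S : {set vertices H}) :
  (forall (T : {set vertices H}) (v : vertices (delete_set T)), T \subset S ->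
     sub_member HH (delete_vertex v) -> sub_member HH (delete_set T)) ->
  sub_member HH (delete_set S) -> sub_member HH H.
Proof.
elim: {S}#|S| {-2}S (erefl #|S|) => [|k IHk] S cardS ext mS.
  apply: sub_member_subgraph mS.
  by rewrite (cards0_eq cardS); apply: subgraph_delete_set0.
have /card_gt0P[v vS] : 0 < #|S| by rewrite cardS.
have sDS : S :\ v \subset S by apply: subsetDl.
have vD : v \in ~: (S :\ v) by rewrite !inE eqxx.
apply: (IHk (S :\ v)).
- by move: cardS; rewrite (cardsD1 v) vS => -[].
- by move=> T w /subset_trans/(_ sDS); apply: ext.
- apply: (ext _ (Sub v vD) sDS); apply: sub_member_subgraph mS.
  by rewrite -[in delete_set S](setD1K vS); apply: delete_vertex_delete_set.
Qed.

End Subgraphs.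

Section Degrees.
Variables (r : nat) (H : hgraph r).
Implicit Types v w : vertices H.

Lemma min_degree_le v : min_degree H <= degree v.
Proof. exact: (bigmin_le (nedges H) v (@degree r H)). Qed.

(** The vertex [v] takes care of the default value of the minimum: [c <= degree v <= nedges H]. *)
Lemma le_min_degree v c : (forall w, c <= degree w) -> c <= min_degree H.
Proof.
move=> cH; apply: (big_ind (leq c)) => [|m n cm cn|w _] //.
  by apply: leq_trans (cH v) _; apply/subset_leq_card/subsetP=> e; rewrite inE => /andP[].
by rewrite leq_min cm.
Qed.

(** Double counting of the incident pairs of a vertex and an edge. *)
Lemma sum_degree : \sum_(v : vertices H) degree v = r * nedges H.
Proof.
under eq_bigr => v _ do rewrite /degree -sum1_card.
under eq_bigr => v _ do rewrite big_mkcond.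
rewrite exchange_big /=.
under eq_bigr => e _ do rewrite -big_mkcond /=.
rewrite /nedges mulnC -sum_nat_const [RHS]big_mkcond; apply: eq_bigr => e _.
case: ifP => eH; last by rewrite big1 // => v; rewrite inE eH.
apply: etrans (edges_uniform eH); rewrite -sum1_card.
by apply: eq_bigl => v; rewrite inE eH.
Qed.

Lemma min_degree_nedges : nverts H * min_degree H <= r * nedges H.
Proof.
by rewrite -sum_degree /nverts -sum_nat_const leq_sum // => v _; apply: min_degree_le.
Qed.

Lemma bin_leq_exp n k : 'C(n, k) <= n ^ k.
Proof.
apply: (@leq_trans (n ^_ k)); first by rewrite -bin_ffact leq_pmulr ?fact_gt0.
by elim: k => [|k IHk] //; rewrite ffactnSr expnSr leq_mul ?leq_subr.
Qed.

(** An edge through [v] and [w] is determined by its other [r - 2] vertices. *)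
Lemma codegree_le v w : v != w ->
  #|[set e in edges H | (v \in e) && (w \in e)]| <= nverts H ^ (r - 2).
Proof.
move=> vw; apply: leq_trans (bin_leq_exp _ _).
rewrite -[X in _ <= X](card_draws (vertices H)).
have D_inj : {in [set e in edges H | (v \in e) && (w \in e)] &,
    injective (fun e => e :\: [set v; w])}.
  move=> e f; rewrite !inE => /and3P[_ ve we] /and3P[_ vf wf] ef.
  by rewrite -(setID e [set v; w]) -(setID f [set v; w]) ef !(setIidPr _) //
             subUset !sub1set ?ve ?vf.
rewrite -(card_in_imset D_inj); apply/subset_leq_card/subsetP => _ /imsetP[e + ->].
rewrite !inE => /and3P[eH ve we].
by rewrite cardsDS ?subUset ?sub1set ?ve // cards2 vw (edges_uniform eH).
Qed.

End Degrees.

Section DeleteSet.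
Variables (r : nat) (H : hgraph r).
Implicit Types S : {set vertices H}.

(** The edges at [v] that avoid [S] survive the deletion. Each lost edge contains [v] and some [w]
    in [S], and the codegree bound applies to each such pair. *)
Lemma degree_delete_set S (v : vertices (delete_set S)) :
  degree (val v) <= degree v + #|S| * nverts H ^ (r - 2).
Proof.
pose A := [set e in edges H | val v \in e].
pose P := [set e : {set vertices H} | e \subset ~: S].
have vS : val v \notin S by have := valP v; rewrite in_setC.
rewrite /degree -/A -(cardsID P A) leq_add //.
  (* A surviving edge is sent to its preimage in the subset type; nothing is lost because it lies
     inside [~: S]. *)
  have P_inj : {in A :&: P &, injective (fun e : {set vertices H} =>
      [set x : vertices (delete_set S) | val x \in e])}.
    move=> e f; rewrite !inE => /andP[_ eS] /andP[_ fS] /setP ef.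
    apply/setP => x; have [xS|xS] := boolP (x \in ~: S).
      by have := ef (Sub x xS); rewrite !inE.
    by rewrite (contraNF (subsetP eS x)) ?(contraNF (subsetP fS x)).
  rewrite -(card_in_imset P_inj); apply/subset_leq_card/subsetP => _ /imsetP[e + ->].
  rewrite !inE => /andP[/andP[eH ve] eS]; rewrite ve andbT.
  rewrite (_ : [set _ | _ in _] = e) //; apply/setP => x.
  apply/imsetP/idP => [[y + ->]|xe]; first by rewrite inE.
  by exists (Sub x (subsetP eS x xe)); rewrite ?inE.
rewrite -sum_nat_const.
apply: (@leq_trans (\sum_(w in S) #|[set e in edges H | (val v \in e) && (w \in e)]|)).
  have cup_le : #|\bigcup_(w in S) [set e in edges H | (val v \in e) && (w \in e)]|
      <= \sum_(w in S) #|[set e in edges H | (val v \in e) && (w \in e)]|.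
    elim/big_rec2: _ => [|w n B _ Bn]; first by rewrite cards0.
    by apply: leq_trans (leq_card_setU _ _) _; rewrite leq_add2l.
  apply: leq_trans cup_le.
  apply/subset_leq_card/subsetP => e; rewrite !inE => /andP[/subsetPn[w we]].
  rewrite in_setC negbK => wS /andP[eH ve].
  by apply/bigcupP; exists w; rewrite ?inE ?eH ?ve.
by apply: leq_sum => w wS; apply: codegree_le; apply: contraNneq vS => ->.
Qed.

Lemma min_degree_delete_set S (v : vertices (delete_set S)) :
  min_degree H <= min_degree (delete_set S) + #|S| * nverts H ^ (r - 2).
Proof.
rewrite addnC -leq_subLR; apply: (le_min_degree v) => w.
rewrite leq_subLR addnC; apply: leq_trans (degree_delete_set w).
exact: min_degree_le.
Qed.

Lemma nverts_delete_set S : nverts (delete_set S) = nverts H - #|S|.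
Proof. by rewrite /nverts card_sig -(cardsC S) addKn; apply: eq_card. Qed.

End DeleteSet.

Local Open Scope ring_scope.

Theorem theorem1p8 (R : realType) (r : nat) (hr : (2 <= r)%N)
    (F HH : hclass r)
    (F_nondegenerate : nondegenerate_family R F)
    (HH_iso_closed : iso_closed HH)
    (HH_hereditary : hereditary HH)
    (HH_free : forall G : hgraph r, HH G -> Ffree F G) :
  vertex_stable R F HH -> vertex_extendable R F HH -> degree_stable R F HH.
Proof.
move=> stable [zeta [N1 [zeta_gt0 ext]]].
(* The bound [zeta / 2] pays for the degree lost by deleting [T]; the bound [1 / 2] leaves at least
   half of the vertices, hence the threshold [2 * N1] below. *)
pose delta : R := Num.min (zeta / 2) (1 / 2).
have delta_gt0 : 0 < delta by rewrite lt_min !divr_gt0.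
have delta_zeta : delta <= zeta / 2 by rewrite ge_min lexx.
have delta_half : delta <= 1 / 2 by rewrite ge_min lexx orbT.
have [eps [N2 [eps_gt0 {}stable]]] := stable delta delta_gt0.
exists (Num.min eps (zeta / 2)), (maxn N2 (2 * N1)); split=> [|H freeH].
  by rewrite lt_min eps_gt0 divr_gt0.
set eps' := Num.min _ _; rewrite geq_max => /andP[leN2 leN1] degH.
have eps'_eps : eps' <= eps by rewrite ge_min lexx.
have eps'_zeta : eps' <= zeta / 2 by rewrite ge_min lexx orbT.
have r_gt0 : (0 < r)%N by apply: ltnW.
have r_ge1 : 1 <= r%:R :> R by rewrite ler1n.
have edgesH : (turan_density R F / r`!%:R - eps) * (nverts H)%:R ^+ r
    <= (nedges H)%:R.
  (* After multiplication by [r], the degree sum gives the edge bound: [r] times the density over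
     [r!] is the density over [(r-1)!], and [eps' <= eps <= r * eps]. *)
  rewrite -(ler_pM2l (lt_le_trans ltr01 r_ge1)).
  apply: (@le_trans _ _ ((nverts H)%:R * (min_degree H)%:R)); last first.
    by rewrite -!natrM ler_nat min_degree_nedges.
  apply: le_trans (ler_wpM2l (ler0n _ _) degH).
  rewrite mulrA [leRHS]mulrCA -exprS prednK // ler_wpM2r ?exprn_ge0 //.
  have factE : (r`!)%:R = r%:R * (r.-1)`!%:R :> R.
    by rewrite -natrM -{1 2}(prednK r_gt0) factS.
  rewrite mulrBr factE invfM mulrCA mulVKf ?pnatr_eq0 -?lt0n // lerB //.
  by apply: le_trans eps'_eps _; rewrite ler_peMl // ltW.
have [S [cardS memS]] := stable H freeH leN2 edgesH.
apply: sub_member_delete_set memS => T v TS memTv.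
have cardT : #|T|%:R <= delta * (nverts H)%:R.
  by apply: le_trans cardS; rewrite ler_nat subset_leq_card.
have leTn : (nverts (delete_set T) <= nverts H)%N.
  by rewrite nverts_delete_set leq_subr.
apply: ext; last by exists v.
- by apply: Ffree_subgraph freeH; apply: induced_subgraph.
- rewrite nverts_delete_set leq_subRL ?max_card // -(ler_nat R) natrD.
  have : (2 * N1)%:R <= (nverts H)%:R :> R by rewrite ler_nat.
  have := ler_wpM2r (ler0n R (nverts H)) delta_half.
  rewrite natrM; lra.
(* The threshold is stated with the order of [H - T]. Replacing it by the larger order of [H]
   strengthens the bound only if the coefficient is positive; otherwise the bound is trivial. *)
have [cle0|cgt0] := leP (turan_density R F / (r.-1)`!%:R - zeta) 0.
  apply: le_trans (ler0n _ _); exact: mulr_le0_ge0 cle0 (exprn_ge0 _ (ler0n _ _)).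
have le_pow : (nverts (delete_set T))%:R ^+ r.-1 <= (nverts H)%:R ^+ r.-1 :> R.
  by rewrite lerXn2r ?nnegrE ?ler0n ?ler_nat.
apply: le_trans (ler_wpM2l (ltW cgt0) le_pow) _.
have degT := min_degree_delete_set v; rewrite -(ler_nat R) natrD in degT.
have codegT : (#|T| * nverts H ^ (r - 2))%:R <= delta * (nverts H)%:R ^+ r.-1.
  have -> : r.-1 = (r - 2).+1 by case: (r) hr => [|[|k]] // _; rewrite !subSS subn0.
  by rewrite natrM natrX exprS mulrA ler_wpM2r ?exprn_ge0.
have pow_ge0 : 0 <= (nverts H)%:R ^+ r.-1 :> R by rewrite exprn_ge0.
(* The two losses, [eps'] from the hypothesis on [H] and [delta] from the deletion, add up to at
   most [zeta]. *)
have := ler_wpM2r pow_ge0 delta_zeta; have := ler_wpM2r pow_ge0 eps'_zeta.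
move: degH degT codegT; rewrite !mulrBl; lra.
Qed.
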